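(* Let $(X,T)$ be a $T_0$-space. Then $\beta_2(X,T)=[({}^{*}X,{}^{S}T)]_0$; that is, the $T_0$-reflection $[({}^{*}X,{}^{S}T)]_0$ of $({}^{*}X,{}^{S}T)$, together with the map $\varphi\circ\eta_X:(X,T)\to[({}^{*}X,{}^{S}T)]_0$, is the $T_0$ locally compact supercompact (weak) reflection of $(X,T)$, where $\eta_X:(X,T)\to({}^{*}X,{}^{S}T)$ is the inclusion map and $\varphi:({}^{*}X,{}^{S}T)\to[({}^{*}X,{}^{S}T)]_0$ is the $T_0$-reflection map.
   Context: Nonstandard setting: fix a nonstandard extension map $*$ on a superstructure containing all the sets under consideration, satisfying the transfer principle, with each $x\in X$ identified with ${}^{*}x$, so that $X\subseteq {}^{*}X$ and ${}^{*}A\cap X=A$ for all $A\subseteq X$. The extension is assumed to be an enlargement, saturated in the following sense: for every set $X$ under consideration and every family $\{F_i\}_{i\in I}$ of subsets of $X$ with the finite intersection property, there is $\alpha\in{}^{*}X$ with $\alpha\in{}^{*}F_i$ for all $i\in I$. For a topological space $(X,T)$, ${}^{S}T$ denotes the (standard) topology on ${}^{*}X$ with base $\{{}^{*}G : G\in T\}$. A topological space $(Y,\tau)$ is locally compact if for every $y\in Y$ and every open $V\in\tau$ containing $y$ there is a compact neighbourhood $W$ of $y$ (not necessarily open) with $W\subseteq V$. It is supercompact if for every ultrafilter $\mathcal{U}$ on the set $Y$ there is an essentially unique point $y\in Y$ such that the set of cluster points $\mathrm{adh}\,\mathcal{U}=\bigcap\{\mathrm{cl}_\tau H : H\in\mathcal{U}\}$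 equals $\mathrm{cl}_\tau\{y\}$; essentially unique means that any other such point has exactly the same $\tau$-neighbourhoods as $y$. $[(Y,\tau)]_0$ denotes the $T_0$-reflection of $(Y,\tau)$, i.e. the quotient space identifying points having the same $\tau$-neighbourhoods, and the $T_0$-reflection map is the quotient map. Weak reflection: $\beta_2(X,T)$, the $T_0$ locally compact supercompact reflection of $(X,T)$, is understood in the weak sense: a $T_0$ locally compact supercompact space $R$ together with a continuous map $e:(X,T)\to R$ such that for every $T_0$ locally compact supercompact space $K$ and every continuous map $f:(X,T)\to K$ there is a continuous map $F:R\to K$, not necessarily unique, with $F\circ e=f$. *)

(* Defs.v *)
From HB Require Import structures.
From mathcomp Require Import all_boot all_classical topology.

Set Implicit Arguments.
Unset Strict Implicit.
Unset Printing Implicit Defensive.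

Local Open Scope classical_set_scope.
Local Open Scope quotient_scope.

(** * Superstructures *)

(* The cumulative hierarchy V_0 = individuals, V_(n+1) = V_n \cup P(V_n). *)
Fixpoint level (T : Type) (indiv : set T) (member : T -> T -> Prop) (n : nat)
    : set T :=
  if n is m.+1 then
    level indiv member m `|`
      [set a | ~ indiv a /\ forall x, member x a -> level indiv member m x]
  else indiv.

(* Up to isomorphism, the union of the V_n(S) over the set S of individuals:
   every element has finite rank, and every subset of every V_n is an element.
   Individuals have no members and are distinct from the empty set. *)
Record superstructure := Superstructure {
  univ :> Type;
  indiv : set univ;
  member : univ -> univ -> Prop;
  indiv_nomem : forall s x, indiv s -> ~ member x s;
  mem_ext : forall a b, ~ indiv a -> ~ indiv b ->
    (forall x, member x a <-> member x b) -> a = b;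
  finite_rank : forall a, exists n, level indiv member n a;
  level_subset : forall n (P : set univ), P `<=` level indiv member n ->
    exists a, ~ indiv a /\ forall x, member x a <-> P x
}.
Arguments indiv {_} _.
Arguments member {_} _ _.

Definition elt (V : superstructure) (A : V) : Type := {x : V | member x A}.

HB.instance Definition _ (V : superstructure) (A : V) := gen_eqMixin (elt A).
HB.instance Definition _ (V : superstructure) (A : V) :=
  gen_choiceMixin (elt A).

Lemma subset_ex (V : superstructure) (A : V) (B : set (elt A)) :
  exists b : V, ~ indiv b /\
    forall x, member x b <-> exists2 y : elt A, B y & sval y = x.
Proof.
have [n An] := finite_rank A.
suff [m sAm] : exists m, forall x, member x A -> level indiv member m x.
  by apply: (@level_subset V m) => _ [y _ <-]; exact/sAm/(svalP y).
elim: n An => [|n IHn] /=.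
  by move=> iA; exists 0%N => x /(indiv_nomem iA).
by case=> [/IHn//|[_ sA]]; exists n.
Qed.

Definition subset_code (V : superstructure) (A : V) (B : set (elt A)) : V :=
  sval (cid (subset_ex B)).

Lemma mem_subset_code (V : superstructure) (A : V) (B : set (elt A)) x :
  member x (subset_code B) <-> exists2 y : elt A, B y & sval y = x.
Proof. by rewrite /subset_code; case: cid => b [? ?]. Qed.

(** * Nonstandard extensions *)

(* The bounded formulas of the language of set theory. *)
Inductive bformula :=
  | BEq of nat & nat
  | BMem of nat & nat
  | BNot of bformula
  | BAnd of bformula & bformula
  | BAll of nat & nat & bformula.

Definition update (T : Type) (v : nat -> T) (i : nat) (x : T) : nat -> T :=
  fun k => if k == i then x else v k.

(* [BAll i j f] is (forall x_i in x_j) f. *)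
Fixpoint sat (V : superstructure) (f : bformula) (v : nat -> V) : Prop :=
  match f with
  | BEq i j => v i = v j
  | BMem i j => member (v i) (v j)
  | BNot g => ~ sat g v
  | BAnd g h => sat g v /\ sat h v
  | BAll i j g => forall x, member x (v j) -> sat g (update v i x)
  end.

(* A map V(S) -> V( *S) sending S to *S and individuals to individuals, for
   which the transfer principle holds. *)
Record nonstandard_extension (V W : superstructure) := NonstandardExtension {
  star :> V -> W;
  star_indiv : forall a, indiv (star a) <-> indiv a;
  star_base : forall S, ~ indiv S -> (forall x, member x S <-> indiv x) ->
    forall y, member y (star S) <-> indiv y;
  transfer : forall (f : bformula) (v : nat -> V),
    sat f v <-> sat f (fun i => star (v i))
}.

Definition star_set (V W : superstructure) (star : nonstandard_extension V W)
    (A : V) (B : set (elt A)) : set (elt (star A)) :=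
  [set alpha | member (sval alpha) (star (subset_code B))].
Arguments star_set {V W} star {A} B _.

(* The empty subfamily has intersection A, so an F with the finite
   intersection property can only exist if A is nonempty. *)
Definition is_enlargement (V W : superstructure)
    (star : nonstandard_extension V W) : Prop :=
  forall A : V, ~ indiv A -> forall F : set (set (elt A)), finI F id ->
    exists alpha : elt (star A), forall B, F B -> star_set star B alpha.

Lemma star_mem (V W : superstructure) (star : nonstandard_extension V W)
  (a b : V) : member (star a) (star b) <-> member a b.
Proof.
exact: iff_sym (transfer star (BMem 0 1) (fun i => if i is 0 then a else b)).
Qed.

(* The embedding x |-> *x of A into *A, by which A is regarded as a part of
   *A. *)
Definition star_elt (V W : superstructure) (star : nonstandard_extension V W)
    (A : V) (x : elt A) : elt (star A) :=
  exist _ (star (sval x)) ((star_mem star _ _).2 (svalP x)).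
Arguments star_elt {V W} star {A} x.

Lemma star_setT (V W : superstructure) (star : nonstandard_extension V W)
  (A : V) : star_set star [set: elt A] = setT.
Proof.
apply/seteqP; split => // -[al /= alA] _; rewrite /star_set /=.
have := transfer star (BAll 2 0 (BMem 2 1))
  (fun i => if i is 0 then A else subset_code [set: elt A]).
case=> /= + _; apply => // x xA; rewrite /update /=.
by apply/mem_subset_code; exists (exist _ x xA).
Qed.

Lemma star_setI (V W : superstructure) (star : nonstandard_extension V W)
  (A : V) (B C : set (elt A)) :
  star_set star (B `&` C) = star_set star B `&` star_set star C.
Proof.
pose v := fun i => match i with
  0 => subset_code B | 1 => subset_code C | _ => subset_code (B `&` C) end.
apply/seteqP; split => -[al /= alA]; rewrite /star_set /=.
- have := transfer star (BAll 3 2 (BAnd (BMem 3 0) (BMem 3 1))) v.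
  case=> /= + _; rewrite /update /=; apply => x /mem_subset_code[y [By Cy] <-].
  by split; apply/mem_subset_code; exists y.
- case; move: al {alA}.
  have := transfer star
    (BAll 3 0 (BNot (BAnd (BMem 3 1) (BNot (BMem 3 2))))) v.
  case=> /= + _; rewrite /update /= => H.
  move=> al alB alC; apply: contrapT => nal; apply: (H _ al alB) => //.
  move=> x /mem_subset_code[y By <-] [/mem_subset_code[z Cz /eq_sig_hprop zy]].
  apply; apply/mem_subset_code; exists y => //; split => //.
  by rewrite -zy// => ? ? ?; exact: Prop_irrelevance.
Qed.

(** * The space *X with the topology ST *)

(* A space X is regarded as the set A of the superstructure through a bijection
   c : X -> elt A, so that the open sets of X become the B : set (elt A) with
   open preimage. [nst_space star c] is *A with the topology of base
   { *B | B open}. *)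
Definition nst_space (V W : superstructure) (star : nonstandard_extension V W)
    (X : topologicalType) (A : V) (c : X -> elt A) : Type := elt (star A).

Section nst_topology.
Context (V W : superstructure) (star : nonstandard_extension V W).
Context (X : topologicalType) (A : V) (c : X -> elt A).

Definition std_open : set (set (elt A)) := [set B | open (c @^-1` B)].

Let star_open_cover : \bigcup_(B in std_open) star_set star B = setT.
Proof.
apply/seteqP; split => // al _; exists setT; last by rewrite star_setT.
by rewrite /std_open /= preimage_setT; exact: openT.
Qed.

Let star_open_join (B C : set (elt A)) (al : elt (star A)) :
  std_open B -> std_open C -> star_set star B al -> star_set star C al ->
  exists D, [/\ std_open D, star_set star D al &
    star_set star D `<=` star_set star B `&` star_set star C].
Proof.
move=> oB oC Bal Cal; exists (B `&` C); rewrite star_setI; split => //.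
by rewrite /std_open /= preimage_setI; exact: openI.
Qed.

HB.instance Definition _ := Choice.on (nst_space star c).
HB.instance Definition _ := @isBaseTopological.Build (nst_space star c)
  (set (elt A)) std_open (star_set star) star_open_cover star_open_join.

End nst_topology.
Arguments nst_space {V W} star {X A} c.

Definition nst_incl (V W : superstructure) (star : nonstandard_extension V W)
    (X : topologicalType) (A : V) (c : X -> elt A) (x : X) : nst_space star c :=
  star_elt star (c x).
Arguments nst_incl {V W} star {X A} c x.

(** * The T0-reflection *)

Section T0_reflection.
Context (Y : topologicalType).

Definition same_nbhs (x y : Y) : bool := `[< nbhs x = nbhs y >].

Let same_nbhs_refl : reflexive same_nbhs.
Proof. by move=> x; apply/asboolP. Qed.

Let same_nbhs_sym : symmetric same_nbhs.
Proof. by move=> x y; apply/asboolP/asboolP => ->. Qed.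

Let same_nbhs_trans : transitive same_nbhs.
Proof. by move=> y x z /asboolP xy /asboolP yz; apply/asboolP; rewrite xy. Qed.

Canonical same_nbhs_equiv :=
  EquivRel same_nbhs same_nbhs_refl same_nbhs_sym same_nbhs_trans.

Definition T0_quotient : topologicalType :=
  quotient_topology {eq_quot same_nbhs_equiv}.

Definition T0_map (y : Y) : T0_quotient :=
  \pi_(quotient_topology {eq_quot same_nbhs_equiv}) y.

End T0_reflection.
Arguments T0_map {Y} y.

(** * Weak reflections *)

(* The library's [locally_compact] only asks for one precompact neighbourhood
   of each point, which is weaker outside Hausdorff spaces. *)
Definition locally_compact_space (Y : topologicalType) : Prop :=
  forall (y : Y) (U : set Y), open U -> U y ->
    exists W : set Y, [/\ nbhs y W, compact W & W `<=` U].

(* [cluster U] is the intersection of the closures of the members of U, by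
   [clusterE]. *)
Definition supercompact_space (Y : topologicalType) : Prop :=
  forall U : set_system Y, UltraFilter U ->
    exists y : Y, cluster U = closure [set y] /\
      forall z : Y, cluster U = closure [set z] -> nbhs z = nbhs y.

Definition T0_locally_compact_supercompact (Y : topologicalType) : Prop :=
  [/\ kolmogorov_space Y, locally_compact_space Y & supercompact_space Y].

Definition weak_reflection (P : topologicalType -> Prop)
    (X R : topologicalType) (e : X -> R) : Prop :=
  [/\ P R, continuous e &
    forall K : topologicalType, P K -> forall f : X -> K, continuous f ->
      exists F : R -> K, continuous F /\ F \o e = f].

(* Main.v *)
Require Import Defs.
From mathcomp Require Import all_boot all_classical topology.

Set Implicit Arguments.
Unset Strict Implicit.
Unset Printing Implicit Defensive.

Local Open Scope classical_set_scope.
Local Open Scope quotient_scope.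

(** Every point [al] of the extension *A determines an ultrafilter on A, namely
    the family of all B with [al] in *B, and the enlargement property says that
    every ultrafilter on A arises in this way.  The space *A thus behaves like
    the space of all ultrafilters on X, with a base of open sets *B for B open,
    except that several points may give the same ultrafilter.

    An ultrafilter F on *A leaves a trace on A, the family of all B with *B in
    F, and this trace is an ultrafilter, hence comes from a point [al].  Since
    [al] lies in *B exactly when *B belongs to F ([nst_ultra_trace]), F converges
    to precisely the points of the closure of [al], which is supercompactness
    ([nst_supercompact]).  Moreover, if F contains *B then its limit [al] lies
    in *B, so every *B is compact ([star_set_compact]); the basic open sets
    being compact, *A is locally compact.

    A continuous f from X to a T0 locally compact supercompact K extends to *A
    ([nst_extension]): push the ultrafilter of [al] forward along f; its limits
    form the closure of one point, and this point is the value at [al].  Local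
    compactness of K makes the extension continuous: if a compact C inside an
    open O is a neighbourhood of the value at [al], then for every [be] near
    [al] the ultrafilter pushed from [be] contains C, so it has a limit in C,
    and the value at [be], having that limit in its closure, belongs to O.

    The T0-reflection costs nothing.  Open sets are saturated for the relation
    of having the same neighbourhoods, so any choice of representatives is a
    continuous section of the quotient map ([T0_repr_continuous]).  Local
    compactness and supercompactness descend along this pair of maps, and
    continuous maps into T0 spaces factor through the quotient. *)

(** * Ultrafilters and specialization *)

(** Converse of [in_ultra_setVsetC]. *)
Lemma ultra_setVsetC (T : Type) (F : set_system T) :
  ProperFilter F -> (forall B, F B \/ F (~` B)) -> UltraFilter F.
Proof.
move=> FF Fprime; split=> // G GG FG.
apply/seteqP; split=> // B GB; have [//|/FG GnB] := Fprime B.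
by case: (@filter_not_empty _ G _); rewrite -(setICr B); exact: filterI.
Qed.

Lemma ultra_fmap (T U : Type) (f : T -> U) (F : set_system T) :
  UltraFilter F -> UltraFilter (f @ F).
Proof.
move=> FU; apply: ultra_setVsetC => B.
exact: (in_ultra_setVsetC (f @^-1` B) FU).
Qed.

Lemma cvg_openP (Y : topologicalType) (F : set_system Y) (y : Y) :
  Filter F -> (F --> y) <-> (forall O, open O -> O y -> F O).
Proof.
move=> FF; split=> [Fy O oO Oy|Fy B]; first exact/Fy/open_nbhs_nbhs.
by rewrite nbhsE => -[O [oO Oy] OB]; apply: filterS OB (Fy O oO Oy).
Qed.

Lemma nbhs_eq_open (Y : topologicalType) (y z : Y) (O : set Y) :
  nbhs y = nbhs z -> open O -> O y -> O z.
Proof.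
by move=> yz oO Oy; apply: nbhs_singleton; rewrite -yz; exact: open_nbhs_nbhs.
Qed.

Lemma closure1P (Y : topologicalType) (y z : Y) :
  closure [set y] z <-> (forall O, open O -> O z -> O y).
Proof.
split=> [zy O oO Oz|zy B].
  by have [_ [-> ]] := zy O (open_nbhs_nbhs (conj oO Oz)).
by rewrite nbhsE => -[O [oO Oz] OB]; exists y; split=> //; apply: OB; exact: zy.
Qed.

Lemma closure1_nbhs (Y : topologicalType) (y z : Y) :
  closure [set y] = closure [set z] -> nbhs y = nbhs z.
Proof.
move=> yz.
have /closure1P yz' : closure [set z] y.
  by rewrite -yz; exact: subset_closure.
have /closure1P zy' : closure [set y] z.
  by rewrite yz; exact: subset_closure.
rewrite !nbhsE; apply/seteqP; split=> B [O [oO Oy] OB]; exists O => //.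
  by split=> //; exact: yz'.
by split=> //; exact: zy'.
Qed.

Lemma nbhs_closure1 (Y : topologicalType) (y z : Y) :
  nbhs y = nbhs z -> closure [set y] = closure [set z].
Proof.
by move=> yz; apply/seteqP; split=> t /closure1P ty; apply/closure1P => O oO;
  move=> /(ty O oO); apply: nbhs_eq_open.
Qed.

Lemma closure1_continuous (Y Z : topologicalType) (f : Y -> Z) (y z : Y) :
  continuous f -> closure [set y] z -> closure [set f y] (f z).
Proof.
move=> /continuousP cf /closure1P zy; apply/closure1P => O oO.
exact: (zy (f @^-1` O) (cf _ oO)).
Qed.

(** Closures of points determine neighbourhoods, so the essential uniqueness
    required of the generic cluster point is automatic. *)
Lemma supercompactP (Y : topologicalType) :
  supercompact_space Y <->
  (forall U : set_system Y, UltraFilter U ->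
     exists y, cluster U = closure [set y]).
Proof.
split=> sY U UU; first by have [y [Uy _]] := sY U UU; exists y.
have [y Uy] := sY U UU; exists y; split=> // z Uz.
by apply: closure1_nbhs; rewrite -Uy.
Qed.

Lemma kolmogorov_nbhs_inj (Y : topologicalType) (y z : Y) :
  kolmogorov_space Y -> nbhs y = nbhs z -> y = z.
Proof.
move=> T0 yz; apply/eqP; apply: contraT => /T0[B].
rewrite !inE yz => -[] [Bn nB]; first by have := nbhs_singleton Bn.
by rewrite -yz in Bn; have := nbhs_singleton Bn.
Qed.

(** * The T0-reflection *)

Section T0.
Context (Y : topologicalType).
Implicit Types (y z : Y) (q : T0_quotient Y).

Definition T0_repr (q : T0_quotient Y) : Y := repr q.

Lemma T0_reprK q : T0_map (T0_repr q) = q.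
Proof. exact: reprK. Qed.

Lemma T0_map_eq y z : T0_map y = T0_map z <-> nbhs y = nbhs z.
Proof.
have -> : (T0_map y = T0_map z) = (y = z %[mod {eq_quot same_nbhs_equiv Y}]).
  by [].
by split=> [/eqmodP/asboolP|yz]; last exact/eqmodP/asboolP.
Qed.

Lemma T0_repr_nbhs y : nbhs (T0_repr (T0_map y)) = nbhs y.
Proof. by apply/T0_map_eq; rewrite T0_reprK. Qed.

Lemma T0_map_continuous : continuous (@T0_map Y).
Proof. exact: pi_continuous. Qed.

(** An open set of Y contains a point as soon as it contains the chosen
    representative of its class, so it is the preimage under [T0_map] of its
    preimage under [T0_repr]. *)
Lemma T0_repr_continuous : continuous T0_repr.
Proof.
apply/continuousP => O oO; rewrite /open/= /quotient_open.
suff -> : @T0_map Y @^-1` (T0_repr @^-1` O) = O by [].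
by apply/seteqP; split=> y; apply: (@nbhs_eq_open _ _ _ O) => //;
  rewrite T0_repr_nbhs.
Qed.

Lemma T0_quotient_kolmogorov : kolmogorov_space (T0_quotient Y).
Proof.
move=> p q; apply: contra_neqP => /forallNP noB.
rewrite -(T0_reprK p) -(T0_reprK q); apply/T0_map_eq.
suff H (r s : T0_quotient Y) :
    (forall B, ~ (B \in nbhs r /\ s \in ~` B)) ->
    nbhs (T0_repr r) `<=` nbhs (T0_repr s).
  apply/seteqP; split; apply: H => B rsB; apply: (noB B); [by left|by right].
move=> rs B; rewrite !nbhsE => -[O [oO Or] OB].
exists O => //; split=> //; apply: contrapT => nOs.
apply: (rs (T0_repr @^-1` O)); rewrite !inE; split=> //.
by apply: T0_repr_continuous; exact: open_nbhs_nbhs.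
Qed.

Lemma T0_quotient_locally_compact :
  locally_compact_space Y -> locally_compact_space (T0_quotient Y).
Proof.
move=> lcY q U oU Uq.
have [||B [Bq cB BU]] := lcY (T0_repr q) (@T0_map Y @^-1` U).
- exact: oU.
- by rewrite /preimage/= T0_reprK.
exists (@T0_map Y @` B); split.
- apply: (@filterS _ _ _ (T0_repr @^-1` B)) (T0_repr_continuous Bq) => r Br.
  by exists (T0_repr r) => //; exact: T0_reprK.
- apply: continuous_compact cB; apply: continuous_subspaceT.
  exact: T0_map_continuous.
- by move=> _ [y By <-]; exact: BU.
Qed.

(** The two maps carry limits of an ultrafilter U on the quotient to limits of
    its image under [T0_repr] and back, so a generic cluster point upstairs maps
    to one of U. *)
Lemma T0_quotient_supercompact :
  supercompact_space Y -> supercompact_space (T0_quotient Y).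
Proof.
move=> /supercompactP sY; apply/supercompactP => U UU.
have rU := ultra_fmap T0_repr UU.
have [y Uy] := sY _ rU; exists (T0_map y).
rewrite ultra_cvg_clusterE in Uy.
rewrite ultra_cvg_clusterE; apply/seteqP; split=> q /=.
  move=> Uq; rewrite -(T0_reprK q).
  apply: closure1_continuous; first exact: T0_map_continuous.
  rewrite -Uy.
  exact: (cvg_trans (cvg_app T0_repr Uq) (@T0_repr_continuous q)).
move=> /(closure1_continuous T0_repr_continuous) qy.
have : closure [set y] (T0_repr q).
  by rewrite -(nbhs_closure1 (T0_repr_nbhs y)).
rewrite -Uy /= => rUq.
have := cvg_trans (cvg_app (@T0_map Y) rUq) (@T0_map_continuous (T0_repr q)).
rewrite T0_reprK => Uq B /Uq; rewrite /= /fmap/=.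
apply: (@filterS _ U _ (T0_repr @^-1` (@T0_map Y @^-1` B))) => r.
by rewrite /preimage/= T0_reprK.
Qed.

Lemma T0_map_lift (K : topologicalType) (f : Y -> K) :
  kolmogorov_space K -> continuous f ->
  exists F : T0_quotient Y -> K, continuous F /\ F \o @T0_map Y = f.
Proof.
move=> T0K cf; exists (f \o T0_repr); split.
  move=> q; apply: continuous_comp; first exact: T0_repr_continuous.
  exact: cf.
apply/funext => y /=; apply: kolmogorov_nbhs_inj => //; apply: closure1_nbhs.
move/continuousP: cf => cf.
apply/seteqP; split=> t /closure1P H; apply/closure1P => O oO /(H O oO);
  apply: (@nbhs_eq_open _ _ _ (f @^-1` O)); by [rewrite T0_repr_nbhs|exact: cf].
Qed.

End T0.

(** * The space of the extension *)

Section Nonstandard.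
Context (V W : superstructure) (star : nonstandard_extension V W) (A : V).
Implicit Types (B C : set (elt A)) (al : elt (star A)).

Lemma subset_code_elt B (x : elt A) : member (sval x) (subset_code B) <-> B x.
Proof.
split=> [/mem_subset_code[y By /eq_sig_hprop yx]|Bx].
  by rewrite -yx// => ? ? ?; exact: Prop_irrelevance.
by apply/mem_subset_code; exists x.
Qed.

Lemma star_set_elt B (x : elt A) : star_set star B (star_elt star x) <-> B x.
Proof. by rewrite /star_set/= star_mem subset_code_elt. Qed.

Lemma star_set0 : star_set star (set0 : set (elt A)) = set0.
Proof.
apply/seteqP; split=> // -[al alA]; rewrite /star_set/=.
(* Transfer of: every x in the empty set differs from itself. *)
have := transfer star (BAll 1 0 (BNot (BEq 1 1)))
  (fun=> subset_code (set0 : set (elt A))).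
case=> /= + _ => H /H; rewrite /update/=; apply=> //.
by move=> x /mem_subset_code[].
Qed.

Lemma star_setC B : star_set star (~` B) = ~` star_set star B.
Proof.
apply/seteqP; split=> [al nBal Bal|[al alA]].
  have : (star_set star B `&` star_set star (~` B)) al by [].
  by rewrite -star_setI setICr star_set0.
(* Transfer of: every x in A lies in B or in the complement of B. *)
rewrite /star_set/=.
pose v := fun i => match i with
  0 => A | 1 => subset_code B | _ => subset_code (~` B) end.
have := transfer star
  (BAll 3 0 (BNot (BAnd (BNot (BMem 3 1)) (BNot (BMem 3 2))))) v.
case=> /= + _; rewrite /update/= => H nB; apply: contrapT => nC.
apply: (H _ al alA) => // x xA [].
rewrite -[x]/(sval (exist _ x xA : elt A)).
move=> /(contra_not (subset_code_elt _ _).2) nBx; apply.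
exact/subset_code_elt.
Qed.

Lemma star_setS B C : B `<=` C -> star_set star B `<=` star_set star C.
Proof. by move=> /setIidPl <-; rewrite star_setI => al []. Qed.

Definition point_filter al : set_system (elt A) :=
  [set B | star_set star B al].

Lemma point_filter_ultra al : UltraFilter (point_filter al).
Proof.
apply: ultra_setVsetC.
  apply: Build_ProperFilter_ex; last first.
    split=> [|B C|B C BC]; rewrite /point_filter/=.
    - by rewrite star_setT.
    - by rewrite star_setI.
    - exact: star_setS.
  move=> B Bal; apply: contrapT => /set0P/negP; rewrite negbK => /eqP B0.
  by move: Bal; rewrite /point_filter/= B0 star_set0.
by move=> B; rewrite /point_filter/= star_setC; exact: EM.
Qed.

Lemma point_filter_elt (x : elt A) :
  point_filter (star_elt star x) = principal_filter x.
Proof.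
apply/seteqP; split=> B; first by move=> /star_set_elt/principal_filterP.
by move=> /principal_filterP/star_set_elt.
Qed.

(** An ultrafilter has the finite intersection property, so its members are
    realized by one point; the filter of that point contains the ultrafilter
    and equals it by maximality. *)
Lemma enlargement_ultra (F : set_system (elt A)) :
  is_enlargement star -> ~ indiv A -> UltraFilter F ->
  exists al, point_filter al = F.
Proof.
move=> enl A_set FU.
have [|al Fal] := enl A A_set F; first by apply: (@filter_finI _ F).
by exists al; have PU := point_filter_ultra al; apply: max_filter.
Qed.

Context (X : topologicalType) (c : X -> elt A).
Local Notation sX := (nst_space star c).

Lemma nst_nbhsE (al : sX) (U : set sX) :
  nbhs al U <->
  exists B, [/\ std_open c B, star_set star B al & star_set star B `<=` U].
Proof.
rewrite nbhsE; split=> [[O [[D sD <-] [B DB Bal]] OU]|[B [oB Bal BU]]].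
  exists B; split=> //; first exact: sD.
  by move=> be Bbe; apply: OU; exists B.
exists (star_set star B) => //; split=> //.
by exists [set B]; [move=> _ ->|rewrite bigcup_set1].
Qed.

Lemma star_set_open B : std_open c B -> open (star_set star B : set sX).
Proof.
move=> oB; rewrite openE => al Bal; apply/nst_nbhsE.
by exists B; split.
Qed.

Lemma nst_cvgP (F : set_system sX) (al : sX) : Filter F ->
  (F --> al) <->
  (forall B, std_open c B -> star_set star B al -> F (star_set star B)).
Proof.
move=> FF; split=> [Fal B oB Bal|Fal U /nst_nbhsE[B [oB Bal BU]]].
  by apply: Fal; apply/nst_nbhsE; exists B; split.
by apply: filterS BU _; exact: Fal.
Qed.

Lemma nst_closure1P (al be : sX) : closure [set al] be <->
  (forall B, std_open c B -> star_set star B be -> star_set star B al).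
Proof.
split=> [/closure1P ba B oB|ba]; first exact: ba (star_set_open oB).
apply/closure1P => O oO Obe.
have /nst_nbhsE[B [oB /(ba _ oB) Bal]] : nbhs be O by exact: open_nbhs_nbhs.
exact.
Qed.

Definition trace_filter (F : set_system sX) : set_system (elt A) :=
  [set B | F (star_set star B)].

Lemma trace_filter_ultra (F : set_system sX) :
  UltraFilter F -> UltraFilter (trace_filter F).
Proof.
move=> FU; apply: ultra_setVsetC.
  apply: Build_ProperFilter_ex; last first.
    split=> [|B C|B C BC]; rewrite /trace_filter/=.
    - by rewrite star_setT; exact: filterT.
    - by rewrite star_setI; exact: filterI.
    - by apply: filterS; exact: star_setS.
  move=> B FB; apply: contrapT => /set0P/negP; rewrite negbK => /eqP B0.
  by move: FB; rewrite /trace_filter/= B0 star_set0 => /filter_not_empty.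
by move=> B; rewrite /trace_filter/= star_setC; exact: in_ultra_setVsetC.
Qed.

Lemma nst_incl_continuous : continuous (nst_incl star c).
Proof.
move=> x U /nst_nbhsE[B [oB /star_set_elt Bx BU]].
rewrite nbhsE; exists (c @^-1` B) => // y Bcy.
exact/BU/star_set_elt.
Qed.

Section Enlargement.
Context (enl : is_enlargement star) (A_set : ~ indiv A).

(** The point realizing the trace of F is a generic limit of F that moreover
    lies in every set *B belonging to F, as compactness of *B demands. *)
Lemma nst_ultra_trace (F : set_system sX) : UltraFilter F ->
  exists al : sX, forall B, star_set star B al <-> F (star_set star B).
Proof.
move=> FU.
have [al alF] := enlargement_ultra enl A_set (trace_filter_ultra FU).
exists al => B; rewrite -[X in X <-> _]/(point_filter al B).
by rewrite alF.
Qed.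

Lemma star_set_compact B : compact (star_set star B : set sX).
Proof.
rewrite compact_ultra => F FU FB; have [al alF] := nst_ultra_trace FU.
exists al; split; first exact/alF.
by apply/nst_cvgP => C _ /alF.
Qed.

Lemma nst_locally_compact : locally_compact_space sX.
Proof.
move=> al U oU Ual.
have /nst_nbhsE[B [oB Bal BU]] : nbhs al U by exact: open_nbhs_nbhs.
exists (star_set star B); split=> //; last exact: star_set_compact.
by apply/nst_nbhsE; exists B; split.
Qed.

Lemma nst_supercompact : supercompact_space sX.
Proof.
apply/supercompactP => F FU; have [al alF] := nst_ultra_trace FU.
exists al; rewrite ultra_cvg_clusterE; apply/seteqP; split=> be /=.
  by move=> /nst_cvgP Fbe; apply/nst_closure1P => B oB /(Fbe _ oB)/alF.
by move=> /nst_closure1P ba; apply/nst_cvgP => B oB /(ba _ oB)/alF.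
Qed.

End Enlargement.

(** The value at [al] is the generic limit of the ultrafilter pushed forward
    along f.  Supercompactness of K provides it; local compactness of K makes
    the choice continuous, and T0 makes it agree with f on X. *)
Lemma nst_extension (K : topologicalType) (f : X -> K) :
  bijective c -> T0_locally_compact_supercompact K -> continuous f ->
  exists F : sX -> K, continuous F /\ F \o nst_incl star c = f.
Proof.
move=> [d cK dK] [T0K lcK scK] /continuousP cf.
pose push (al : sX) := (f \o d) @ point_filter al.
have pushU al : UltraFilter (push al).
  exact/ultra_fmap/point_filter_ultra.
have /choice[F FE] : forall al, exists y, cluster (push al) = closure [set y].
  by move=> al; have /supercompactP := scK; apply.
have F_cvg al : push al --> F al.
  have : cluster (push al) (F al) by rewrite FE; exact: subset_closure.
  by rewrite ultra_cvg_clusterE.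
exists F; split.
  move=> al U; rewrite nbhsE => -[O [oO OFal] OU].
  have [C [CFal cC CO]] := lcK _ _ oO OFal.
  have [N [oN NFal] NC] : exists2 N, open_nbhs (F al) N & N `<=` C.
    by move: CFal; rewrite nbhsE => -[N]; exists N.
  apply/nst_nbhsE; exists ((f \o d) @^-1` N); split.
  - rewrite /std_open/= -comp_preimage.
    have -> : (f \o d) \o c = f by apply/funext => x /=; rewrite cK.
    exact: cf.
  - by apply: F_cvg; exact: open_nbhs_nbhs.
  move=> be Nbe; apply: OU.
  (* A limit w of the pushed ultrafilter that lies in C: it belongs to O and is
     in the closure of F be, hence F be belongs to O. *)
  have [w [Cw]] : C `&` cluster (push be) !=set0.
    apply: cC; rewrite /push /fmap/=.
    by have := point_filter_ultra be => PU; apply: filterS Nbe => z; exact: NC.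
  by rewrite FE => /closure1P; apply=> //; exact: CO.
apply/funext => x /=; apply: kolmogorov_nbhs_inj => //; apply: closure1_nbhs.
(* At a point of X the pushed ultrafilter is principal at f x. *)
rewrite -FE ultra_cvg_clusterE /push /nst_incl point_filter_elt.
have pE (O : set K) : ((f \o d) @ principal_filter (c x)) O <-> O (f x).
  by apply: (iff_trans (principal_filterP _ _)); rewrite /preimage/= cK.
apply/seteqP; split=> y.
  by move=> /cvg_openP H; apply/closure1P => O oO /(H _ oO)/pE.
by move=> /closure1P H; apply/cvg_openP => O oO /(H _ oO)/pE.
Qed.

End Nonstandard.

Theorem proposition4p4 (V W : superstructure)
  (star : nonstandard_extension V W) (enl : is_enlargement star)
  (X : topologicalType) (T0X : kolmogorov_space X)
  (A : V) (A_set : ~ indiv A) (c : X -> elt A) (bijc : bijective c) :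
  weak_reflection T0_locally_compact_supercompact
    (@T0_map (nst_space star c) \o nst_incl star c).
Proof.
split.
- split.
  + exact: T0_quotient_kolmogorov.
  + exact/T0_quotient_locally_compact/nst_locally_compact.
  + exact/T0_quotient_supercompact/nst_supercompact.
- move=> x; apply: continuous_comp; first exact: nst_incl_continuous.
  exact: T0_map_continuous.
- move=> K PK f cf.
  have [F [cF Ff]] := nst_extension star bijc PK cf.
  have [T0K _ _] := PK.
  have [G [cG GF]] := T0_map_lift T0K cF.
  by exists G; split=> //; rewrite compA GF.
Qed.
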